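(* Let $k, r, s$ be arbitrary natural numbers (positive integers) and put $p=\frac{r}{r+s}$, $n=k(r+s)$, $\varepsilon=\frac{1}{r+s}$. Let $X_1,\dots,X_n$ be independent random variables with $\mathbf{Pr}(X_i=1)=p$ and $\mathbf{Pr}(X_i=0)=1-p$. Then $$\mathbf{Pr}\left(\left|\frac1n\sum_{i=1}^n X_i-p\right|>\varepsilon\right)<\exp\{-2\varepsilon^2 n\}.$$ *)

(* Defs.v *)
From HB Require Import structures.
From mathcomp Require Export all_boot all_order all_algebra.
From mathcomp Require Export all_classical all_reals all_analysis.

Set Implicit Arguments.
Unset Strict Implicit.
Unset Printing Implicit Defensive.

Import Order.TTheory GRing.Theory Num.Theory.

Local Open Scope classical_set_scope.
Local Open Scope ring_scope.

(* Mutual (not merely pairwise) independence of a finite family of random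
   variables: the product rule is required for every subfamily [J]. *)
Definition mutually_independent (d d' : measure_display)
    (T : measurableType d) (T' : measurableType d') (R : realType)
    (P : probability T R) (I : finType) (X : I -> {RV P >-> T'}) : Prop :=
  forall (J : {set I}) (B : I -> set T'),
    (forall i, i \in J -> measurable (B i)) ->
    P (\bigcap_(i in [set` J]) (X i @^-1` B i)) =
      (\prod_(i in J) P (X i @^-1` B i))%E.

Arguments mutually_independent {d d' T T' R} P {I} X.

(* Main.v *)
Require Import Defs.
From mathcomp Require Import ring lra zify.

Import Order.TTheory GRing.Theory Num.Theory numFieldNormedType.Exports.
Local Open Scope classical_set_scope.
Local Open Scope ring_scope.

(** Put a = kr, c = ks, n = a + c.  The sum S of the trials is binomial with
    mean exactly a, and since eps n = k the event reads |S - a| > k.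
    Hoeffding's inequality on both sides would lose a factor 2.  It is avoided
    by comparing each tail with the corresponding half of the distribution
    instead of with 1.

    Write b for the mass function of S.  Consecutive masses beyond the mean
    satisfy
      b(a+l+1) / b(a+l) = (c-l) a / ((a+l+1) c) <= exp(-4 l / n),
    because log ((a+l) c / ((c-l) a)) has derivative at least 4/n in l
    ([ratio_le_expR]).  Multiplying t such ratios gives, for every i > a,
      b(i+t) <= exp(-2 t (t+1) / n) b(i)      ([int_mean_pmf_shift]).
    Summing over i > a, the mass beyond a + t is at most exp(-2 t (t+1) / n)
    times the mass beyond a.  Exchanging successes and failures gives the same
    on the left, and the masses strictly on either side of a add up to at most
    1, so that
      Pr(|S - a| > t) <= exp(-2 t (t+1) / n)  ([int_mean_pmf_two_sided_tail]).
    For t = k the exponent is -2 (k+1) / (r+s), strictly below the required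
    -2 eps^2 n = -2 k / (r+s).

    The probabilistic input is only that S has the binomial law
    ([probability_sum_binomial]). *)

(** * Bounding the ratio of consecutive masses *)

(** The bound tanh y <= y in multiplicative form. It is proved from the sign of
    the derivative of (1 + x) exp(-x) - (1 - x) exp(x), which is
    x (exp(x) - exp(-x)). *)
Lemma cayley_le_expR (R : realType) (y : R) : 0 <= y ->
  (1 - y) / (1 + y) <= expR (- 2 * y).
Proof.
move=> y0.
suff: (1 - y) * expR y <= (1 + y) * expR (- y).
  move=> h; rewrite ler_pdivrMr ?ltr_wpDr//.
  rewrite (_ : -2 * y = - y + - y); last by ring.
  rewrite expRD -mulrA -ler_pdivrMl ?expR_gt0// -expRN opprK.
  by rewrite mulrC [leRHS]mulrC.
rewrite -subr_ge0.
pose f (x : R) := (1 + x) * expR (- x) - (1 - x) * expR x.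
have df (x : R) : is_derive x 1 f (x * (expR x - expR (- x))).
  by apply: is_derive_eq; rewrite /GRing.scale/=; ring.
have f0 : f 0 = 0 by rewrite /f oppr0 subrr.
rewrite -/(f y) -f0; apply: (@ger0_derive1_ndecry _ f 0) => //.
- by move=> x; rewrite in_itv/= andbT => x0; rewrite derive1E derive_val
    mulr_ge0 ?ltW// subr_gt0 ltr_expR; lra.
- apply: continuous_subspaceT => x; apply: differentiable_continuous.
  exact/derivable1_diffP.
Qed.

(** Both factors (c - l) / c and a / (a + l) have the form (1 - y) / (1 + y),
    with y = l / (2c - l) and y = l / (2a + l); the two exponents so obtained
    add up to 4 l (a + c) / ((2a + l) (2c - l)), and the denominator is a
    product of numbers of sum 2 (a + c), hence at most (a + c)^2. *)
Lemma ratio_le_expR (R : realType) (a c l : R) : 0 < a -> 0 < c -> 0 <= l ->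
  l <= c -> (c - l) * a / ((a + l) * c) <= expR (- 4 * (l / (a + c))).
Proof.
move=> a0 c0 l0 lc.
have al0 : 0 < a + l by lra.
have u0 : 0 < 2 * a + l by lra.
have v0 : 0 < 2 * c - l by lra.
have -> : (c - l) * a / ((a + l) * c) =
    (1 - l / (2 * a + l)) / (1 + l / (2 * a + l)) *
    ((1 - l / (2 * c - l)) / (1 + l / (2 * c - l))).
  by field; rewrite !gt_eqF//; lra.
apply: (@le_trans _ _ (expR (- 2 * (l / (2 * a + l))) *
                       expR (- 2 * (l / (2 * c - l))))).
  have fr (w : R) : 0 < w -> l <= w -> 0 <= (1 - l / w) / (1 + l / w).
    move=> w0 lw; rewrite divr_ge0// ?subr_ge0 ?ler_pdivrMr ?mul1r//.
    by rewrite addr_ge0// divr_ge0// ltW.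
  by apply: ler_pM; [apply: fr|apply: fr|apply: cayley_le_expR|
    apply: cayley_le_expR] => //; rewrite ?divr_ge0//; lra.
rewrite -expRD ler_expR.
have -> : - 2 * (l / (2 * a + l)) + - 2 * (l / (2 * c - l)) =
    - 4 * (l * ((a + c) / ((2 * a + l) * (2 * c - l)))).
  by field; rewrite !gt_eqF.
rewrite ler_nM2l; last lra.
apply: ler_wpM2l => //.
rewrite ler_pdivlMr ?mulr_gt0// mulrC ler_pdivrMr; last lra.
rewrite -subr_ge0 (_ : _ - _ = (a - c + l) ^+ 2) ?sqr_ge0//; ring.
Qed.

(** * Binomial laws with integer mean *)

Lemma binomial_pmf_rev (R : realType) (n : nat) (p : R) (j : nat) :
  (j <= n)%N -> binomial_pmf n p (n - j) = binomial_pmf n (1 - p) j.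
Proof.
move=> jn; rewrite /binomial_pmf /unstable.onem subKn// subKr bin_sub//.
by rewrite mulrC.
Qed.

Lemma sum_binomial_pmf (R : realType) (n : nat) (p : R) :
  \sum_(j < n.+1) binomial_pmf n p j = 1.
Proof.
under eq_bigr do rewrite /binomial_pmf mulrC.
by rewrite -exprDn subrK expr1n.
Qed.

Section integer_mean.
Context {R : realType}.
Implicit Types a c i j l t : nat.

(** Parametrising by the expected numbers a of successes and c of failures turns
    the reflection of the distribution into a swap of the two arguments. *)
Definition int_mean_prob a c : R := a%:R / (a + c)%:R.

Definition int_mean_pmf a c j : R := binomial_pmf (a + c) (int_mean_prob a c) j.

Lemma int_mean_probC a c : (0 < a + c)%N ->
  1 - int_mean_prob a c = int_mean_prob c a.
Proof.
move=> ac; rewrite /int_mean_prob [(c + a)%N]addnC natrD; field.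
by rewrite -natrD pnatr_eq0 -lt0n.
Qed.

Lemma int_mean_pmf_ge0 a c j : 0 <= int_mean_pmf a c j.
Proof.
apply: binomial_pmf_ge0; rewrite /int_mean_prob divr_ge0//=.
have [->|ac] := posnP (a + c)%N; first by rewrite invr0 mulr0.
by rewrite ler_pdivrMr ?ltr0n// mul1r ler_nat leq_addr.
Qed.

Lemma int_mean_pmf_rev a c j : (j <= a + c)%N ->
  int_mean_pmf a c (a + c - j) = int_mean_pmf c a j.
Proof.
have [/eqP|ac] := posnP (a + c)%N.
  by rewrite addn_eq0 => /andP[/eqP-> /eqP->]; rewrite leqn0 => /eqP->.
by move=> jn; rewrite /int_mean_pmf binomial_pmf_rev// int_mean_probC// addnC.
Qed.

Lemma int_mean_pmf_step a c l : (0 < a)%N -> (0 < c)%N ->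
  int_mean_pmf a c (a + l).+1 <=
  expR (- 4 * (l%:R / (a + c)%:R)) * int_mean_pmf a c (a + l).
Proof.
move=> a0 c0; have [cl|lc] := leqP c l.
  (* Beyond n the binomial coefficient, hence the mass, vanishes. *)
  rewrite {1}/int_mean_pmf/binomial_pmf bin_small ?mulr0n ?mulr_ge0 ?expR_ge0//.
    exact: int_mean_pmf_ge0.
  by rewrite ltnS leq_add2l.
have aR : (0 : R) < a%:R by rewrite ltr0n.
have cR : (0 : R) < c%:R by rewrite ltr0n.
have lcR : (l%:R : R) <= c%:R by rewrite ler_nat ltnW.
have l0 : (0 : R) <= l%:R by [].
have -> : int_mean_pmf a c (a + l).+1 =
    (c%:R - l%:R) * a%:R / ((a%:R + l%:R + 1) * c%:R) *
    int_mean_pmf a c (a + l).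
  have bE : ((a + l).+1%:R : R) * 'C(a + c, (a + l).+1)%:R =
      (c%:R - l%:R) * 'C(a + c, a + l)%:R.
    by rewrite -natrM mul_bin_left natrM subnDl natrB// ltnW.
  rewrite /int_mean_pmf /binomial_pmf /unstable.onem
    int_mean_probC ?addn_gt0 ?a0//.
  have -> : (a + c - (a + l) = (a + c - (a + l).+1).+1)%N by lia.
  rewrite -[LHS]mulr_natr -[in RHS](mulr_natr (_ * _)) !exprS.
  move: bE; rewrite -natr1 natrD => bE.
  have k0 : (a%:R + l%:R + 1 : R) != 0 by rewrite gt_eqF//; lra.
  apply: (mulfI k0); rewrite mulrCA bE /int_mean_prob addnC natrD; field.
  by rewrite k0 !gt_eqF// addr_gt0.
apply: ler_wpM2r; first exact: int_mean_pmf_ge0.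
rewrite (natrD _ a c).
apply: le_trans _ (ratio_le_expR _ _ _ _ aR cR l0 lcR).
apply: ler_wpM2l; first by rewrite mulr_ge0// subr_ge0.
by rewrite lef_pV2 ?posrE ?mulr_gt0//; lra.
Qed.

Definition gauss_factor a c t : R :=
  expR (- 2 * ((t * t.+1)%:R / (a + c)%:R)).

(** Starting from the first point i = a + 1 beyond the mean, the t steps
    contribute the exponents -4 l / n for l = 1, ..., t, of sum
    -2 t (t + 1) / n; from a later i they only contribute more. *)
Lemma int_mean_pmf_shift a c i t : (0 < a)%N -> (0 < c)%N -> (a < i)%N ->
  int_mean_pmf a c (i + t) <= gauss_factor a c t * int_mean_pmf a c i.
Proof.
move=> a0 c0 ai; elim: t => [|t IH].
  by rewrite addn0 /gauss_factor mul0n mul0r mulr0 expR0 mul1r.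
have -> : (i + t.+1 = (a + (i + t - a)).+1)%N by lia.
apply: le_trans (int_mean_pmf_step _ _ _ a0 c0) _.
rewrite subnKC; last by lia.
apply: le_trans (ler_wpM2l (expR_ge0 _) IH) _.
rewrite mulrA; apply: ler_wpM2r; first exact: int_mean_pmf_ge0.
rewrite -expRD ler_expR.
rewrite (_ : - 4 * _ = - 2 * ((2 * (i + t - a))%:R / (a + c)%:R)); last first.
  by rewrite natrM; ring.
rewrite -mulrDr -mulrDl -natrD; apply: ler_wnM2l; first lra.
by apply: ler_wpM2r; rewrite ?invr_ge0// ler_nat; nia.
Qed.

(** Translating the indices by t maps the half-line beyond a onto the one beyond
    a + t, so the termwise bound sums up. *)
Lemma int_mean_pmf_upper_tail a c t : (0 < a)%N -> (0 < c)%N ->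
  \sum_(j < (a + c).+1 | (a + t < j)%N) int_mean_pmf a c j <=
  gauss_factor a c t * \sum_(j < (a + c).+1 | (a < j)%N) int_mean_pmf a c j.
Proof.
move=> a0 c0.
have E u : \sum_(j < (a + c).+1 | (a + u < j)%N) int_mean_pmf a c j =
    \sum_(a.+1 + u <= j < (a + c).+1) int_mean_pmf a c j.
  rewrite -(big_mkord (fun j => a + u < j)%N (int_mean_pmf a c)).
  by rewrite [RHS](@big_nat_widenl _ _ _ _ 0%N).
have := E 0%N; rewrite !addn0 => ->; rewrite E big_addn.
rewrite (big_nat_widen _ _ (a + c).+1) ?leq_subr//= mulr_sumr big_mkcond/=.
rewrite big_seq [leRHS]big_seq; apply: ler_sum => j.
rewrite mem_index_iota => /andP[aj _]; case: ifP => _.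
  exact: int_mean_pmf_shift.
by rewrite mulr_ge0 ?expR_ge0 ?int_mean_pmf_ge0.
Qed.

Lemma int_mean_pmf_lower_tail a c t :
  \sum_(j < (a + c).+1 | (j + t < a)%N) int_mean_pmf a c j =
  \sum_(j < (c + a).+1 | (c + t < j)%N) int_mean_pmf c a j.
Proof.
rewrite [in RHS]addnC (reindex_inj rev_ord_inj)/=.
apply: eq_big => [j|j _].
  by rewrite subSS; have := ltn_ord j; lia.
by rewrite subSS int_mean_pmf_rev// -ltnS.
Qed.

(** No factor 2 appears: each tail is a fraction of the mass on its own side of
    the mean, and these two masses together are at most 1. *)
Lemma int_mean_pmf_two_sided_tail a c t : (0 < a)%N -> (0 < c)%N ->
  \sum_(j < (a + c).+1 | ((a + t < j) || (j + t < a))%N) int_mean_pmf a c j <=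
  gauss_factor a c t.
Proof.
move=> a0 c0.
have tailsE u :
    \sum_(j < (a + c).+1 | ((a + u < j) || (j + u < a))%N) int_mean_pmf a c j =
    \sum_(j < (a + c).+1 | (a + u < j)%N) int_mean_pmf a c j +
    \sum_(j < (a + c).+1 | (j + u < a)%N) int_mean_pmf a c j.
  rewrite (bigID (fun j : 'I_ _ => a + u < j)%N)/=.
  by congr (_ + _); apply: eq_bigl => j; lia.
have le1 :
    \sum_(j < (a + c).+1 | ((a + 0 < j) || (j + 0 < a))%N) int_mean_pmf a c j
    <= 1.
  rewrite -(sum_binomial_pmf _ (a + c) (int_mean_prob a c)) big_mkcond/=.
  by apply: ler_sum => j _; case: ifP => // _; exact: int_mean_pmf_ge0.
rewrite tailsE; apply: (@le_trans _ _ (gauss_factor a c t *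
  \sum_(j < (a + c).+1 | ((a + 0 < j) || (j + 0 < a))%N) int_mean_pmf a c j)).
  rewrite tailsE mulrDr addn0 lerD ?int_mean_pmf_upper_tail//.
  rewrite !int_mean_pmf_lower_tail addn0 {1}/gauss_factor [X in _ / X%:R]addnC.
  exact: int_mean_pmf_upper_tail.
by rewrite -[leRHS]mulr1 ler_wpM2l// expR_ge0.
Qed.

End integer_mean.

(** * The law of a sum of independent Bernoulli variables *)

Section independent_bernoulli_sum.
Context {R : realType} {d : measure_display} {T : measurableType d}.
Context (P : probability T R) (n : nat) (p : R) (X : 'I_n -> {RV P >-> R}).
Context (indX : mutually_independent P X).
Context (PX1 : forall i, P (X i @^-1` [set 1]) = p%:E).
Context (PX0 : forall i, P (X i @^-1` [set 0]) = (1 - p)%:E).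

(** The intersection ranges over the full finite set, written as a member of
    [{set 'I_n}], to match the product rule of mutual independence. *)
Definition outcome (A : {set 'I_n}) : set T :=
  \bigcap_(i in [set` [set: 'I_n]%SET]) X i @^-1` [set (i \in A)%:R].

Lemma measurable_outcome A : measurable (outcome A).
Proof.
apply: fin_bigcap_measurable; first exact: finite_finset.
by move=> i _; apply: measurable_funPTI => //; exact: measurable_set1.
Qed.

Lemma outcomeE A w : outcome A w -> A = [set i | X i w == 1]%SET.
Proof.
move=> Aw; apply/setP => i; rewrite inE.
have /= -> : X i w = (i \in A)%:R by apply: Aw; rewrite /= inE.
by case: (i \in A); rewrite ?eqxx// eq_sym oner_eq0.
Qed.

Lemma sum_outcome A w : outcome A w -> \sum_(i < n) X i w = #|A|%:R.
Proof.
move=> Aw; rewrite -sum1_card natr_sum [RHS]big_mkcond/=; apply: eq_bigr => i _.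
have /= -> : X i w = (i \in A)%:R by apply: Aw; rewrite /= inE.
by case: (i \in A).
Qed.

Lemma probability_outcome A :
  P (outcome A) = (p ^+ #|A| * (1 - p) ^+ (n - #|A|))%:E.
Proof.
rewrite /outcome indX; last by move=> i _; exact: measurable_set1.
rewrite (eq_bigr (fun i => (if i \in A then p else 1 - p)%:E)); last first.
  by move=> i _; case: (i \in A); rewrite ?PX1 ?PX0.
rewrite prodEFin; congr (_%:E).
rewrite (bigID (mem A))/=; congr (_ * _).
  rewrite -prodr_const; apply: eq_big => [i|i /andP[_ ->]//].
  by rewrite inE.
transitivity (\prod_(i in ~: A) (1 - p)).
  apply: eq_big => [i|i /andP[_ /negbTE->]//].
  by rewrite !inE.
by rewrite prodr_const cardsCs finset.setCK card_ord.
Qed.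

Lemma binomial_pmf_subsets (Q : pred nat) :
  \sum_(A : {set 'I_n} | Q #|A|) p ^+ #|A| * (1 - p) ^+ (n - #|A|) =
  \sum_(j < n.+1 | Q j) binomial_pmf n p j.
Proof.
have cA (A : {set 'I_n}) : (#|A| < n.+1)%N.
  by rewrite ltnS -[leqRHS]card_ord max_card.
rewrite (partition_big (fun A => Ordinal (cA A)) (fun j : 'I_n.+1 => Q j))//=.
apply: eq_bigr => j Qj.
transitivity (\sum_(A in [set A : {set 'I_n} | #|A| == j]%SET)
                 (p ^+ j * (1 - p) ^+ (n - j))).
  apply: eq_big => [A|A /andP[_ /eqP<-]//].
  rewrite inE -val_eqE/=; case: (#|A| =P j :> nat) => [->|]; last first.
    by rewrite andbF.
  by rewrite Qj.
by rewrite sumr_const card_draws card_ord.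
Qed.

Let S (w : T) : R := \sum_(i < n) X i w.

Lemma measurable_trial_sum : measurable_fun setT S.
Proof. exact: measurable_sum. Qed.

Lemma measurable_preimage_sum (D : set R) : measurable D ->
  measurable (S @^-1` D).
Proof.
by move=> mD; rewrite -[_ @^-1` _]setTI; exact: measurable_trial_sum.
Qed.

(** The outcomes only cover the space up to a null set, so the decomposition
    along them directly yields an inequality. *)
Lemma binomial_le_sum (D : set R) : measurable D ->
  ((\sum_(j < n.+1 | j%:R \in D) binomial_pmf n p j)%:E <= P (S @^-1` D))%E.
Proof.
move=> mD.
pose Q (A : {set 'I_n}) := (#|A|%:R : R) \in D.
pose F := [set` Q].
have mO : measurable (\bigcup_(A in F) outcome A).
  apply: fin_bigcup_measurable; first exact: finite_finset.
  by move=> A _; exact: measurable_outcome.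
apply: (@le_trans _ _ (P (\bigcup_(A in F) outcome A))); last first.
  apply: le_measure; rewrite ?inE//; first exact: measurable_preimage_sum.
  move=> w [A AF Aw] /=; rewrite /S (sum_outcome _ _ Aw).
  exact: set_mem.
rewrite measure_fin_bigcup//; last 3 first.
- exact: finite_finset.
- by move=> A B _ _ [w [/outcomeE -> /outcomeE ->]].
- by move=> A _; exact: measurable_outcome.
rewrite /F -(@bigfs _ _ _ _ (index_enum {set 'I_n}))/=; last 2 first.
- exact: index_enum_uniq.
- by move=> A _; rewrite mem_index_enum.
rewrite (eq_bigr _ (fun A _ => probability_outcome A)).
rewrite sumEFin lee_fin.
by rewrite (binomial_pmf_subsets (fun j => j%:R \in D)).
Qed.

(** The lower bound for D and for its complement add up to 1 on both sides, so
    each of them is an equality. *)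
Lemma probability_sum_binomial (D : set R) : measurable D ->
  P (S @^-1` D) = (\sum_(j < n.+1 | j%:R \in D) binomial_pmf n p j)%:E.
Proof.
move=> mD; apply/eqP; rewrite eq_le binomial_le_sum// andbT.
have := binomial_le_sum (~` D) (measurableC mD).
rewrite preimage_setC probability_setC; last exact: measurable_preimage_sum.
have -> : \sum_(j < n.+1 | j%:R \in ~` D) binomial_pmf n p j =
    1 - \sum_(j < n.+1 | j%:R \in D) binomial_pmf n p j.
  rewrite (eq_bigl (fun j : 'I_n.+1 => j%:R \notin D)) => [|j].
    have := sum_binomial_pmf R n p.
    by rewrite (bigID (fun j : 'I_n.+1 => j%:R \in D))/=; lra.
  by rewrite in_setC.
have /fineK <- := fin_num_measure P _ (measurable_preimage_sum _ mD).
by rewrite -EFinB !lee_fin; lra.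
Qed.

End independent_bernoulli_sum.

Theorem corollary1 (R : realType) (d : measure_display) (T : measurableType d)
    (P : probability T R) (k r s : nat)
    (k_gt0 : (0 < k)%N) (r_gt0 : (0 < r)%N) (s_gt0 : (0 < s)%N) :
  let p : R := r%:R / (r + s)%:R in
  let n : nat := (k * (r + s))%N in
  let eps : R := 1 / (r + s)%:R in
  forall X : 'I_n -> {RV P >-> R},
    mutually_independent P X ->
    (forall i, P (X i @^-1` [set 1]) = p%:E) ->
    (forall i, P (X i @^-1` [set 0]) = (1 - p)%:E) ->
    (P [set w | (`|1 / n%:R * (\sum_(i < n) X i w) - p| > eps)%R]
      < (expR (- 2 * eps ^+ 2 * n%:R))%:E)%E.
Proof.
move=> p n eps X indX PX1 PX0.
set a := (k * r)%N; set c := (k * s)%N.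
have a0 : (0 < a)%N by rewrite muln_gt0 k_gt0.
have c0 : (0 < c)%N by rewrite muln_gt0 k_gt0.
have nE : n = (a + c)%N by rewrite /n mulnDr.
have kR : (k%:R : R) != 0 by rewrite pnatr_eq0 -lt0n.
have mR : (0 : R) < r%:R + s%:R by rewrite -natrD ltr0n addn_gt0 r_gt0.
have nR : n%:R = k%:R * (r%:R + s%:R) :> R by rewrite /n natrM natrD.
have pE : p = int_mean_prob a c.
  by rewrite /p /int_mean_prob -nE nR /a natrM natrD; field; rewrite kR gt_eqF.
pose D : set R := [set x | eps < `|1 / n%:R * x - p|].
have mD : measurable D.
  have mf : measurable_fun setT (fun x : R => `|1 / n%:R * x - p|).
    by apply: measurableT_comp => //;
      apply: measurable_realfun.measurable_funB => //;
      exact: measurable_realfun.measurable_funM.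
  rewrite (_ : D =
    (fun x : R => `|1 / n%:R * x - p|) @^-1` `]eps, +oo[%classic).
    by rewrite -[_ @^-1` _]setTI; apply: mf => //; exact: measurable_itv.
  by apply/seteqP; split=> x /=; rewrite in_itv/= andbT.
have DE j : (j%:R \in D) = ((a + k < j) || (j + k < a))%N.
  have -> : (j%:R \in D) = (eps < `|1 / n%:R * j%:R - p|).
    by apply/idP/idP => [/set_mem|h]; [|apply/mem_set].
  have -> : eps = k%:R / n%:R.
    by rewrite /eps nR natrD; field; rewrite kR gt_eqF.
  have -> : 1 / n%:R * j%:R - p = (j%:R - a%:R) / n%:R :> R.
    by rewrite /p nR natrD /a natrM; field; rewrite kR gt_eqF.
  have n0 : (0 : R) < n%:R^-1.
    by rewrite invr_gt0 nR mulr_gt0// ltr0n.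
  rewrite ltr_normr -mulNr !ltr_pM2r// opprB !ltrBrDl.
  by rewrite -!natrD !ltr_nat.
rewrite -[X in P X]/((fun w => \sum_(i < n) X i w) @^-1` D).
rewrite (probability_sum_binomial _ _ _ _ indX PX1 PX0)// lte_fin.
rewrite (eq_bigl _ _ (fun j : 'I_n.+1 => DE j)) pE.
apply: (@le_lt_trans _ _ (gauss_factor a c k)).
  (* The index type of the sum depends on n, which equals a + c only
     propositionally; hence the detour through an arbitrary m. *)
  have tail m : m = (a + c)%N ->
      \sum_(j < m.+1 | ((a + k < j) || (j + k < a))%N)
        binomial_pmf m (int_mean_prob a c) j <= gauss_factor a c k.
    by move=> ->; exact: int_mean_pmf_two_sided_tail.
  exact: tail.
rewrite /gauss_factor ltr_expR -nE nR natrM -[k.+1%:R]natr1.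
have -> : k%:R * (k%:R + 1) / (k%:R * (r%:R + s%:R)) =
  (k%:R + 1) / (r%:R + s%:R) :> R by field; rewrite kR gt_eqF.
have -> : - 2 * eps ^+ 2 * (k%:R * (r%:R + s%:R)) =
  - 2 * (k%:R / (r%:R + s%:R)) by rewrite /eps natrD; field; rewrite gt_eqF.
rewrite ltr_nM2l; last lra.
by rewrite ltr_pM2r ?invr_gt0// ltrDl.
Qed.
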